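(* Let $\xi=(\xi_1,\dots,\xi_m)\in\{0,1\}^m$ be a random vector with independent Bernoulli coordinates, $\xi_i=1$ with probability $p_i$ and $0$ otherwise. Let $A=(a_{ij})$ be an $m\times m$ real matrix, $\sigma_i^2=p_i(1-p_i)$, $D_{\max}=\|A\|_\infty\vee\|A\|_1$, and $$S_\star=\sum_{i,j}a_{ij}\xi_i\xi_j-\mathbb{E}\sum_{i,j}a_{ij}\xi_i\xi_j.$$ Then for every $\lambda\in\mathbb{R}$ with $|\lambda|\le \frac{1}{16(\|A\|_1\vee\|A\|_\infty)}$, $$\mathbb{E}\exp(\lambda S_\star)\ \le\ \exp\Big(32.5\,\lambda^2D_{\max}e^{8|\lambda|D_{\max}}\sum_{i\ne j}|a_{ij}|\sigma_i^2\sigma_j^2\Big)\cdot\exp\Big(2\lambda^2D_{\max}e^{4|\lambda|D_{\max}}\Big(\sum_{i=1}^m|a_{ii}|\sigma_i^2+2\sum_{i\ne j}|a_{ij}|p_ip_j\Big)\Big).$$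
   Context: $\|A\|_\infty=\max_i\sum_j|a_{ij}|$ and $\|A\|_1=\max_j\sum_i|a_{ij}|$ are the maximum absolute row and column sums; $x\vee y=\max(x,y)$; sums over $i\ne j$ are over ordered pairs of distinct indices in $\{1,\dots,m\}$. *)

(* Defs.v *)
From mathcomp Require Export all_boot all_order all_algebra.
From mathcomp Require Export all_classical all_reals all_analysis.

Set Implicit Arguments.
Unset Strict Implicit.
Unset Printing Implicit Defensive.

Import Order.TTheory GRing.Theory Num.Theory.

Local Open Scope classical_set_scope.
Local Open Scope ring_scope.

(* Maximum absolute row sum and maximum absolute column sum. The entries
   [`|A i j|] are nonnegative, so starting the maximum from 0 only matters
   for the empty matrix. *)
Definition mx_norm_oo (R : realType) (m : nat) (A : 'M[R]_m) : R :=
  \big[Num.max/0]_(i < m) \sum_(j < m) `|A i j|.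

Definition mx_norm_1 (R : realType) (m : nat) (A : 'M[R]_m) : R :=
  \big[Num.max/0]_(j < m) \sum_(i < m) `|A i j|.

Section random_vector.
Context (d : measure_display) (T : measurableType d) (R : realType).
Context (P : probability T R).

(* Mutual independence of a finite family of real random variables. *)
Definition mutually_independent (m : nat) (X : 'I_m -> {RV P >-> R}) : Prop :=
  forall (J : {set 'I_m}) (B : 'I_m -> set R),
    (forall i, measurable (B i)) ->
    P (\bigcap_(i in [set` J]) (X i @^-1` B i)) =
    (\prod_(i in J) P (X i @^-1` B i))%E.

(* The law of [X] charges 1 with mass [p] and 0 with mass [1 - p]; in
   particular [X] is {0,1}-valued almost surely and [0 <= p <= 1]. *)
Definition is_bernoulli (X : {RV P >-> R}) (p : R) : Prop :=
  P (X @^-1` [set 1]) = p%:E /\ P (X @^-1` [set 0]) = (1 - p)%:E.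

Definition quadratic_form (m : nat) (A : 'M[R]_m) (X : 'I_m -> {RV P >-> R})
    (w : T) : R :=
  \sum_(i < m) \sum_(j < m) A i j * X i w * X j w.

End random_vector.

(* Main.v *)
(* Replacing [xi] by a point of the cube with its product law, write
   xi_i = p_i + z_i, so that S = Q + L with Q = \sum_(i != j) a_ij z_i z_j and
   L = \sum_i b_i z_i, where b_i = a_ii + \sum_(j != i) (a_ij + a_ji) p_j.
   By Cauchy-Schwarz it suffices to bound E exp(2 lambda L) and
   E exp(2 lambda Q). For L, use e^t <= 1 + t + t^2/2 e^|t| and |b_i| <= 2 D.
   For Q, Jensen's inequality over a random bipartition of the indices replaces
   2 lambda Q by 8 lambda \sum_(i in J, j notin J) a_ij z_i z_j; integrating out
   z_i for i in J leaves exp(theta \sum_i sigma_i^2 c_i^2) with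
   c_i = \sum_j a_ij z_j, and c_i^2 <= D \sum_j |a_ij| z_j^2 makes the exponent
   separable in the remaining coordinates. *)

Require Import Defs.
From mathcomp Require Import all_boot all_order all_algebra.
From mathcomp Require Import all_classical all_reals all_analysis.
From mathcomp Require Import measurable_realfun.
From mathcomp Require Import ring lra.

Set Implicit Arguments.
Unset Strict Implicit.
Unset Printing Implicit Defensive.

Import Order.TTheory GRing.Theory Num.Theory.
Import numFieldNormedType.Exports.

Local Open Scope classical_set_scope.
Local Open Scope ring_scope.

(** * Elementary bounds on the exponential and a weighted Cauchy-Schwarz inequality *)

Section real_inequalities.
Context (R : realType).
Implicit Types (t u v : R).

(** Termwise comparison of power series once degrees 0 and 1 are split off: (k+2)! >= 2 k! bounds
    t^(k+2)/(k+2)! by t^2/2 times |t|^k/k!. *)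
Lemma expR_le_quadratic t : expR t <= 1 + t + t ^+ 2 / 2 * expR `|t|.
Proof.
have cvS : series (exp_coeff t) n.+2 @[n --> \oo] --> expR t.
  have : series (exp_coeff t) @ \oo --> expR t := is_cvg_series_exp_coeff t.
  by rewrite -(cvg_shiftn 2); under eq_fun do rewrite addn2.
have cvA : 1 + t + t ^+ 2 / 2 * series (exp_coeff `|t|) n @[n --> \oo] -->
    1 + t + t ^+ 2 / 2 * expR `|t|.
  apply: cvgD; first exact: cvg_cst.
  by apply: cvgMr; exact: is_cvg_series_exp_coeff.
rewrite -(cvg_lim _ cvS)// -(cvg_lim _ cvA)//.
apply: ler_lim; [by apply/cvg_ex; eexists; exact: cvS|
                 by apply/cvg_ex; eexists; exact: cvA|].
apply: nearW => n; rewrite /series/= !big_nat_recl//= /exp_coeff/=.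
rewrite expr0 expr1 !divr1 addrA lerD2l mulr_sumr; apply: ler_sum => k _.
rewrite (le_trans (ler_norm _))// normrM normrX normfV normr_nat.
rewrite -[t ^+ 2]real_normK ?num_real// mulrACA -exprD add2n ler_wpM2l//.
rewrite -invfM lef_pV2 ?posrE ?mulr_gt0 ?ltr0n ?fact_gt0//.
by rewrite -natrM ler_nat !factS mulnA leq_mul2r (@leq_mul 2 1 k.+2 k.+1)// orbT.
Qed.

(** Inverting 1 - v <= exp(-v) gives (1 - v) exp(v) <= 1, and (1 - v)(1 + 2v) >= 1 holds exactly on
    this interval. *)
Lemma expR_le_affine v : 0 <= v <= 1 / 2 -> expR v <= 1 + 2 * v.
Proof.
move=> /andP[v0 v1]; have := expR_ge1Dx (- v); rewrite expRN => h.
have e0 := expR_gt0 v.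
have : (1 - v) * expR v <= 1.
  by rewrite -ler_pdivlMr// div1r.
nra.
Qed.

(** Used with v = |s| D in [bipartite_mgf_le], to meet the condition u <= 1/2 of [sqr_mgf_le]. *)
Lemma sqr_expR_le_half v : 0 <= v <= 1 / 2 -> v ^+ 2 / 2 * expR v <= 1 / 2.
Proof.
move=> v01; have := expR_le_affine v01; have := expR_ge0 v.
by case/andP: v01; nra.
Qed.

(** Both sides become double sums; once the right one is symmetrised in i and j, |y_i y_j| <= (y_i^2
    + y_j^2)/2 compares them term by term. *)
Lemma sqr_weighted_sum_le (I : finType) (a y : I -> R) :
  (\sum_i a i * y i) ^+ 2 <= (\sum_i `|a i|) * \sum_i `|a i| * y i ^+ 2.
Proof.
have -> : (\sum_i `|a i|) * (\sum_i `|a i| * y i ^+ 2) =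
    \sum_i \sum_j (`|a i| * `|a j|) * ((y i ^+ 2 + y j ^+ 2) / 2).
  have E : (\sum_i `|a i|) * (\sum_i `|a i| * y i ^+ 2) =
      \sum_i \sum_j `|a i| * `|a j| * y j ^+ 2.
    rewrite mulr_suml; apply: eq_bigr => i _; rewrite mulr_sumr.
    by apply: eq_bigr => j _; rewrite mulrA.
  have E2 (x : R) : x = 2^-1 * x + 2^-1 * x by field.
  rewrite E [LHS]E2 {2}exchange_big/= !mulr_sumr -big_split/=.
  apply: eq_bigr => i _; rewrite !mulr_sumr -big_split/=.
  by apply: eq_bigr => j _; field.
rewrite expr2 mulr_suml; apply: ler_sum => i _; rewrite mulr_sumr.
apply: ler_sum => j _; rewrite -normrM.
have yy : `|y i * y j| <= (y i ^+ 2 + y j ^+ 2) / 2.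
  rewrite ler_norml; apply/andP; split.
    by have := sqr_ge0 (y i + y j); rewrite !expr2; lra.
  by have := sqr_ge0 (y i - y j); rewrite !expr2; lra.
apply: le_trans (ler_wpM2l (normr_ge0 _) yy).
by rewrite mulrACA -normrM ler_norm.
Qed.

End real_inequalities.

(** * Product Bernoulli laws on the finite cube *)

Section bernoulli_vector.
Context (R : realType) (I : finType).
Implicit Types (p : I -> R) (f g : {ffun I -> bool} -> R).

Definition bern (q : R) (b : bool) : R := if b then q else 1 - q.

Definition wt p (x : {ffun I -> bool}) : R := \prod_i bern (p i) (x i).

(* Expectation of [f] under the product on the cube of the Bernoulli(p i) laws. *)
Definition Ex p f : R := \sum_x wt p x * f x.

Definition ctr (q : R) (b : bool) : R := b%:R - q.

Lemma wt_ge0 p x : (forall i, 0 <= p i <= 1) -> 0 <= wt p x.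
Proof.
move=> p01; apply: prodr_ge0 => i _; have /andP[p0 p1] := p01 i.
by rewrite /bern; case: (x i); rewrite ?subr_ge0.
Qed.

(** Distributivity of a product of two-term sums; independence enters the computations on the cube
    through this identity. *)
Lemma Ex_prod p (g : I -> bool -> R) :
  Ex p (fun x => \prod_i g i (x i)) =
  \prod_i (p i * g i true + (1 - p i) * g i false).
Proof.
under [RHS]eq_bigr => i _.
  rewrite (_ : _ + _ = \sum_b bern (p i) b * g i b); last by rewrite big_bool.
  over.
rewrite bigA_distr_bigA; apply: eq_bigr => x _.
by rewrite -big_split.
Qed.

Lemma Ex_cst p c : Ex p (fun=> c) = c.
Proof.
rewrite /Ex -mulr_suml -[RHS]mul1r; congr (_ * _).
transitivity (Ex p (fun x => \prod_(i : I) 1)).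
  by apply: eq_bigr => x _; rewrite big1 ?mulr1.
by rewrite (Ex_prod p (fun _ _ => 1)) big1// => i _; ring.
Qed.

Lemma le_Ex p f g : (forall i, 0 <= p i <= 1) -> (forall x, f x <= g x) ->
  Ex p f <= Ex p g.
Proof. by move=> p01 fg; apply: ler_sum => x _; rewrite ler_wpM2l// wt_ge0. Qed.

Lemma eq_Ex p f g : f =1 g -> Ex p f = Ex p g.
Proof. by move=> fg; apply: eq_bigr => x _; rewrite fg. Qed.

Lemma ExZ p c f : Ex p (fun x => c * f x) = c * Ex p f.
Proof. by rewrite mulr_sumr; apply: eq_bigr => x _; rewrite mulrCA. Qed.

Lemma ExZr p c f : Ex p (fun x => f x * c) = Ex p f * c.
Proof. by rewrite mulr_suml; apply: eq_bigr => x _; rewrite mulrA. Qed.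

Lemma ExD p f g : Ex p (fun x => f x + g x) = Ex p f + Ex p g.
Proof. by rewrite -big_split; apply: eq_bigr => x _; rewrite mulrDr. Qed.

Lemma Ex_sum p (J : finType) (F : J -> {ffun I -> bool} -> R) :
  Ex p (fun x => \sum_j F j x) = \sum_j Ex p (F j).
Proof.
by rewrite exchange_big; apply: eq_bigr => x _; rewrite mulr_sumr.
Qed.

Lemma Ex_exchange p q (F : {ffun I -> bool} -> {ffun I -> bool} -> R) :
  Ex p (fun x => Ex q (F x)) = Ex q (fun y => Ex p (F^~ y)).
Proof.
rewrite [RHS]Ex_sum; apply: eq_bigr => x _.
by rewrite -ExZ.
Qed.

Lemma Ex_coord p i (g : bool -> R) :
  Ex p (fun x => g (x i)) = p i * g true + (1 - p i) * g false.
Proof.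
(* Padding with factors 1 makes the integrand a product over all coordinates, as [Ex_prod]
   requires. *)
pose h k b := if k == i then g b else 1.
rewrite (@eq_Ex _ _ (fun x => \prod_k h k (x k))) => [|x]; last first.
  rewrite (bigD1 i)//= {1}/h eqxx big1 ?mulr1// => k ki.
  by rewrite /h (negbTE ki).
rewrite Ex_prod (bigD1 i)//= {1 2}/h eqxx big1 ?mulr1// => k ki.
by rewrite /h (negbTE ki); ring.
Qed.

Lemma Ex_coord2 p i j (g h : bool -> R) : i != j ->
  Ex p (fun x => g (x i) * h (x j)) =
  (p i * g true + (1 - p i) * g false) * (p j * h true + (1 - p j) * h false).
Proof.
move=> ij; pose k l b := if l == i then g b else if l == j then h b else 1.
have ji : j == i = false by rewrite eq_sym (negbTE ij).
rewrite (@eq_Ex _ _ (fun x => \prod_l k l (x l))) => [|x]; last first.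
  rewrite (bigD1 i)//= (bigD1 j) ?ji//= {1 2}/k ji !eqxx big1 ?mulr1//.
  by move=> l /andP[li lj]; rewrite /k (negbTE li) (negbTE lj).
rewrite Ex_prod (bigD1 i)//= (bigD1 j) ?ji//= {1 2 3 4}/k ji !eqxx big1 ?mulr1//.
by move=> l /andP[li lj]; rewrite /k (negbTE li) (negbTE lj); ring.
Qed.

(** Jensen through the tangent line at the mean m: exp(f) >= exp(m) (1 + f - m), and the right side
    averages to exp(m). *)
Lemma expR_Ex_le p f : (forall i, 0 <= p i <= 1) ->
  expR (Ex p f) <= Ex p (fun x => expR (f x)).
Proof.
move=> p01; set m := Ex p f.
apply: (@le_trans _ _ (Ex p (fun x => expR m * (1 + (f x - m))))).
  by rewrite ExZ !ExD !Ex_cst subrr addr0 mulr1.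
apply: le_Ex => // x; rewrite -[in X in _ <= X](subrKC m (f x)) expRD.
by rewrite ler_wpM2l ?expR_ge0// expR_ge1Dx.
Qed.

(* Resampling a subset of the independent coordinates preserves the law. *)
Lemma Ex_mix p (d : pred I) f :
  Ex p (fun y => Ex p (fun x => f [ffun i => if d i then x i else y i])) =
  Ex p f.
Proof.
(* By linearity it is enough to treat indicators of points, which are products over the coordinates
   and hence factorise under [Ex]. *)
pose ind (z x : {ffun I -> bool}) : R := \prod_i (x i == z i)%:R.
have indE x z : ind z x = (x == z)%:R.
  rewrite /ind; have [->|] := eqVneq x z.
    by rewrite big1// => i _; rewrite eqxx.
  move=> xz; have [i xzi] : exists i, x i != z i.
    apply/existsP; apply: contraNT xz; rewrite negb_exists => /forallP h.
    by apply/eqP/ffunP => i; apply/eqP; rewrite -[_ == _]negbK h.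
  by rewrite (bigD1 i)//= (negbTE xzi) mul0r.
have fE x : f x = \sum_z f z * ind z x.
  rewrite (bigD1 x)//= indE eqxx mulr1 big1 ?addr0// => z zx.
  by rewrite indE eq_sym (negbTE zx) mulr0.
under eq_Ex => y.
  under eq_Ex => x do rewrite fE.
  rewrite Ex_sum.
  over.
rewrite [RHS](eq_Ex _ fE) !Ex_sum; apply: eq_bigr => z _.
under eq_Ex => y do rewrite ExZ.
rewrite !ExZ; congr (_ * _); rewrite /ind (Ex_prod p (fun i b => (b == z i)%:R)).
pose h i (b : bool) : R := (b == z i)%:R.
pose e i := p i * h i true + (1 - p i) * h i false.
(* Averaging over x turns the factors in [d] into their means [e i] and leaves the others as
   functions of y; averaging over y then yields [e i] everywhere. *)
pose k i b := if d i then e i else h i b.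
transitivity (Ex p (fun y => \prod_i k i (y i))).
  apply: eq_Ex => y.
  rewrite -[LHS]/(Ex p (fun x => \prod_i h i ([ffun i => if d i then x i else y i] i))).
  under eq_Ex => x do under eq_bigr => i _ do rewrite ffunE.
  rewrite (Ex_prod p (fun i b => h i (if d i then b else y i))).
  by apply: eq_bigr => i _; rewrite /k /e /=; case: (d i); ring.
rewrite Ex_prod; apply: eq_bigr => i _.
by rewrite /k /e /h; case: (d i); ring.
Qed.

End bernoulli_vector.

(** * Exponential moments of centred linear forms and of sums of squares *)

Section moment_generating_functions.
Context (R : realType) (I : finType) (p : I -> R).
Hypothesis p01 : forall i, 0 <= p i <= 1.

Let p0 i : 0 <= p i. Proof. by case/andP: (p01 i). Qed.
Let p1 i : 0 <= 1 - p i. Proof. by rewrite subr_ge0; case/andP: (p01 i). Qed.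

(** After [expR_le_quadratic] at both atoms the linear term cancels by centring and the quadratic
    one yields the variance; 1 + x <= exp(x) restores an exponential. *)
Lemma bernoulli_mgf_le (q t M : R) : 0 <= q <= 1 -> `|t| <= M ->
  q * expR (t * ctr q true) + (1 - q) * expR (t * ctr q false) <=
  expR (q * (1 - q) * (t ^+ 2 / 2 * expR M)).
Proof.
move=> /andP[q0 q1] tM.
have ub c : `|c| <= 1 ->
    expR (t * c) <= 1 + t * c + c ^+ 2 * (t ^+ 2 / 2 * expR M).
  move=> c1; apply: le_trans (expR_le_quadratic _) _; rewrite lerD2l.
  rewrite [leRHS](_ : _ = (t * c) ^+ 2 / 2 * expR M); last by field.
  rewrite ler_wpM2l ?divr_ge0 ?sqr_ge0// ler_expR normrM.
  by rewrite (le_trans _ tM)// ler_piMr.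
have ubT : `|ctr q true| <= 1 by rewrite /ctr ler_norml/=; apply/andP; split; lra.
have ubF : `|ctr q false| <= 1 by rewrite /ctr ler_norml/=; apply/andP; split; lra.
have q1' : 0 <= 1 - q by lra.
apply: le_trans (expR_ge1Dx _).
apply: le_trans (lerD (ler_wpM2l q0 (ub _ ubT))
                      (ler_wpM2l q1' (ub _ ubF))) _.
by rewrite /ctr/= le_eqVlt; apply/orP; left; apply/eqP; field.
Qed.

Lemma bernoulli_sqr_mgf_le (q u : R) : 0 <= q <= 1 -> 0 <= u <= 1 / 2 ->
  q * expR (u * ctr q true ^+ 2) + (1 - q) * expR (u * ctr q false ^+ 2) <=
  expR (2 * u * (q * (1 - q))).
Proof.
move=> /andP[q0 q1] /andP[u0 u1].
have ub c : 0 <= c ^+ 2 <= 1 -> expR (u * c ^+ 2) <= 1 + 2 * (u * c ^+ 2).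
  by move=> /andP[c0 c1]; apply: expR_le_affine; nra.
have ubT : 0 <= ctr q true ^+ 2 <= 1 by rewrite sqr_ge0/= /ctr/=; nra.
have ubF : 0 <= ctr q false ^+ 2 <= 1 by rewrite sqr_ge0/= /ctr/=; nra.
have q1' : 0 <= 1 - q by lra.
apply: le_trans (expR_ge1Dx _).
apply: le_trans (lerD (ler_wpM2l q0 (ub _ ubT))
                      (ler_wpM2l q1' (ub _ ubF))) _.
by rewrite /ctr/= le_eqVlt; apply/orP; left; apply/eqP; ring.
Qed.

(** A separable exponent factorises under the product law, so one-coordinate bounds multiply. *)
Lemma Ex_expR_sum (g : I -> bool -> R) (B : I -> R) :
  (forall i, p i * expR (g i true) + (1 - p i) * expR (g i false) <=
             expR (B i)) ->
  Ex p (fun x => expR (\sum_i g i (x i))) <= expR (\sum_i B i).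
Proof.
move=> gB; rewrite (@eq_Ex _ _ _ _ (fun x => \prod_i expR (g i (x i)))).
  rewrite (Ex_prod p (fun i b => expR (g i b))) expR_sum.
  by apply: ler_prod => i _; rewrite gB addr_ge0// mulr_ge0 ?expR_ge0.
by move=> x; rewrite expR_sum.
Qed.

Lemma linear_mgf_le (t : I -> R) (M : R) : (forall i, `|t i| <= M) ->
  Ex p (fun x => expR (\sum_i t i * ctr (p i) (x i))) <=
  expR (\sum_i p i * (1 - p i) * (t i ^+ 2 / 2 * expR M)).
Proof.
move=> tM; apply: (Ex_expR_sum (g := fun i b => t i * ctr (p i) b)) => i.
exact: bernoulli_mgf_le.
Qed.

Lemma sqr_mgf_le (u : I -> R) : (forall i, 0 <= u i <= 1 / 2) ->
  Ex p (fun x => expR (\sum_i u i * ctr (p i) (x i) ^+ 2)) <=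
  expR (\sum_i 2 * u i * (p i * (1 - p i))).
Proof.
move=> uM; apply: (Ex_expR_sum (g := fun i b => u i * ctr (p i) b ^+ 2)) => i.
exact: bernoulli_sqr_mgf_le.
Qed.

(** * Exponential moments of quadratic forms by decoupling *)

Section quadratic.
Variables (a : I -> I -> R) (D : R).
Hypothesis a_row : forall i, \sum_j `|a i j| <= D.
Hypothesis a_col : forall j, \sum_i `|a i j| <= D.

Let z i (x : {ffun I -> bool}) := ctr (p i) (x i).

Lemma ctr_le1 i b : `|ctr (p i) b| <= 1.
Proof.
by have := p0 i; have := p1 i; rewrite /ctr ler_norml; case: b => /= *; apply/andP; split; lra.
Qed.

Lemma var_ge0 i : 0 <= p i * (1 - p i).
Proof. exact: mulr_ge0. Qed.

Lemma var_le1 i : p i * (1 - p i) <= 1.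
Proof. by have := p0 i; have := p1 i; nra. Qed.

Lemma bipartite_mgf_le (d : pred I) (s : R) : `|s| * D <= 1 / 2 ->
  Ex p (fun x => expR (s * \sum_i \sum_j
          (d i)%:R * (~~ d j)%:R * (a i j * z i x * z j x))) <=
  expR (s ^+ 2 * D * expR (`|s| * D) *
        \sum_i \sum_j `|a i j| * (p i * (1 - p i)) * (p j * (1 - p j))).
Proof.
move=> sD.
pose c i y := \sum_j a i j * ((~~ d j)%:R * z j y).
(* The factor t^2/2 exp(M) of [linear_mgf_le] for t = s c_i and M = |s| D, with c_i^2 taken out. *)
pose th := s ^+ 2 / 2 * expR (`|s| * D).
have th0 : 0 <= th by rewrite mulr_ge0 ?expR_ge0 ?divr_ge0 ?sqr_ge0.
have cD i y : `|c i y| <= D.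
  apply: le_trans (a_row i); apply: le_trans (ler_norm_sum _ _ _) _.
  apply: ler_sum => j _; rewrite normrM ler_piMr// normrM.
  by case: (d j) => /=; rewrite ?normr0 ?mul0r// normr1 mul1r ctr_le1.
(* The sign of [D] is known only in the presence of an index: nothing forces it when [I] is
   empty. *)
have D0 (i : I) : 0 <= D by apply: le_trans (a_row i); apply: sumr_ge0.
have cc i y : c i y ^+ 2 <= D * \sum_j `|a i j| * z j y ^+ 2.
  apply: le_trans (sqr_weighted_sum_le _ _) _.
  have S0 : 0 <= \sum_j `|a i j| * z j y ^+ 2.
    by apply: sumr_ge0 => j _; rewrite mulr_ge0 ?sqr_ge0.
  apply: le_trans (ler_wpM2r S0 (a_row i)).
  rewrite ler_wpM2l ?sumr_ge0//; apply: ler_sum => j _.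
  rewrite ler_wpM2l//; case: (d j) => /=; last by rewrite mul1r.
  by rewrite mul0r expr0n sqr_ge0.
(* Coordinates in [d] now come from x and the others from y, so for fixed y the exponent is linear
   in x with coefficients s c_i(y) on [d]. *)
rewrite -(Ex_mix p d).
(* The coefficient of z_j^2 after bounding c_i^2 by [cc] and exchanging the sums over i and j. *)
pose u j := th * D * \sum_i `|a i j| * (p i * (1 - p i)).
apply: (@le_trans _ _ (Ex p (fun y => expR (\sum_j u j * z j y ^+ 2)))).
  apply: le_Ex => // y.
  rewrite (@eq_Ex _ _ _ _ (fun x =>
      expR (\sum_i (s * (d i)%:R * c i y) * ctr (p i) (x i)))); last first.
    move=> x; congr expR; rewrite mulr_sumr; apply: eq_bigr => i _.
    rewrite [in RHS]mulr_sumr mulr_suml mulr_sumr; apply: eq_bigr => j _.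
    rewrite /z !ffunE; case: (d i); case: (d j) => /=; ring.
  apply: le_trans (linear_mgf_le (M := `|s| * D) _) _.
    move=> i; rewrite -mulrA normrM ler_wpM2l// normrM.
    by case: (d i); rewrite ?normr1 ?mul1r// normr0 mul0r (D0 i).
  rewrite ler_expR.
  apply: (@le_trans _ _ (\sum_i p i * (1 - p i) *
      (th * (D * \sum_j `|a i j| * z j y ^+ 2)))).
    apply: ler_sum => i _; rewrite ler_wpM2l ?var_ge0//.
    apply: le_trans (ler_wpM2l th0 (cc i y)).
    rewrite -mulrA exprMn [leLHS](_ : _ = (d i)%:R * (th * c i y ^+ 2)).
      by rewrite ler_piMl ?lern1 ?leq_b1// mulr_ge0 ?sqr_ge0.
    by rewrite /th; case: (d i) => /=; field.
  rewrite le_eqVlt; apply/orP; left; apply/eqP.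
  under eq_bigr => i _ do rewrite !mulr_sumr.
  rewrite exchange_big; apply: eq_bigr => j _.
  rewrite /u mulr_sumr mulr_suml; apply: eq_bigr => i _; ring.
(* Column sums give u_j <= th D^2 = v^2/2 exp(v) with v = |s| D <= 1/2. The factor 2 produced here
   cancels the 1/2 inside [th]. *)
apply: le_trans (sqr_mgf_le (u := u) _) _.
  move=> j; have w0 : 0 <= \sum_i `|a i j| * (p i * (1 - p i)).
    by apply: sumr_ge0 => i _; rewrite mulr_ge0 ?var_ge0.
  have wD : \sum_i `|a i j| * (p i * (1 - p i)) <= D.
    apply: le_trans (a_col j); apply: ler_sum => i _.
    by rewrite ler_piMr ?var_le1.
  have thD0 : 0 <= th * D := mulr_ge0 th0 (D0 j).
  rewrite /u (mulr_ge0 thD0 w0)/=; apply: le_trans (ler_wpM2l thD0 wD) _.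
  have -> : th * D * D = (`|s| * D) ^+ 2 / 2 * expR (`|s| * D).
    by rewrite /th -[s ^+ 2]real_normK ?num_real//; field.
  by apply: sqr_expR_le_half; rewrite (mulr_ge0 (normr_ge0 s) (D0 j)).
rewrite ler_expR le_eqVlt; apply/orP; left; apply/eqP.
rewrite exchange_big/= mulr_sumr; apply: eq_bigr => j _.
rewrite /u !mulr_sumr mulr_suml; apply: eq_bigr => i _.
by rewrite /th; field.
Qed.

Hypothesis a_diag : forall i, a i i = 0.

(* A uniformly random [d] keeps each off-diagonal pair with probability 1/4. *)
Lemma Ex_random_bipartition (y : I -> I -> R) :
  \sum_i \sum_j a i j * y i j = 4 * Ex (fun=> 1 / 2) (fun d : {ffun I -> bool} =>
    \sum_i \sum_j (d i)%:R * (~~ d j)%:R * (a i j * y i j)).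
Proof.
rewrite Ex_sum mulr_sumr; apply: eq_bigr => i _.
rewrite Ex_sum mulr_sumr; apply: eq_bigr => j _.
rewrite ExZr; have [<-|ij] := eqVneq i j; first by rewrite a_diag !(mul0r,mulr0).
by rewrite (Ex_coord2 _ (fun b => b%:R) (fun b => (~~ b)%:R) ij)/=; field.
Qed.

(** The factor 4 of the random bipartition leads to [bipartite_mgf_le] with s = 8 lam: hence the
    threshold 1/16 = (1/2)/8 and the constant 64 = 8^2. That bound does not depend on the
    bipartition, so averaging over [d] costs nothing. *)
Lemma quadratic_mgf_le (lam : R) : `|lam| * D <= 1 / 16 ->
  Ex p (fun x => expR (2 * lam * \sum_i \sum_j a i j * z i x * z j x)) <=
  expR (64 * lam ^+ 2 * D * expR (8 * `|lam| * D) *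
        \sum_i \sum_j `|a i j| * (p i * (1 - p i)) * (p j * (1 - p j))).
Proof.
move=> lD; have half01 : 0 <= (1 / 2 : R) <= 1 by lra.
pose Q (d x : {ffun I -> bool}) := expR (8 * lam * \sum_i \sum_j
  (d i)%:R * (~~ d j)%:R * (a i j * z i x * z j x)).
apply: (@le_trans _ _ (Ex p (fun x => Ex (fun=> 1 / 2) (fun d : {ffun I -> bool} => Q d x)))).
  apply: le_Ex => // x.
  apply: le_trans (expR_Ex_le _ (fun=> half01)); rewrite ExZ ler_expR.
  rewrite (@eq_bigr _ _ _ _ _ _ _ (fun i => \sum_j a i j * (z i x * z j x))); last first.
    by move=> i _; apply: eq_bigr => j _; rewrite mulrA.
  rewrite Ex_random_bipartition mulrA.
  rewrite (_ : 2 * lam * 4 = 8 * lam); last by ring.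
  rewrite le_eqVlt; apply/orP; left; apply/eqP; congr (_ * _).
  by apply: eq_Ex => d; apply: eq_bigr => i _; apply: eq_bigr => j _; rewrite !mulrA.
rewrite Ex_exchange -[leRHS](@Ex_cst R I (fun=> 1 / 2)).
apply: le_Ex => // d; apply: le_trans (bipartite_mgf_le _ _) _.
  by rewrite normrM ger0_norm//; lra.
rewrite normrM (ger0_norm (_ : 0 <= 8))// exprMn ler_expR.
by rewrite le_eqVlt; apply/orP; left; apply/eqP; ring.
Qed.

End quadratic.
End moment_generating_functions.

(** * Decomposition of the Boolean chaos and its exponential moment *)

Section chaos.
Context (R : realType) (I : finType) (p : I -> R) (a : I -> I -> R) (D : R).
Hypothesis p01 : forall i, 0 <= p i <= 1.
Hypothesis a_row : forall i, \sum_j `|a i j| <= D.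
Hypothesis a_col : forall j, \sum_i `|a i j| <= D.

Definition boolean_chaos (x : {ffun I -> bool}) : R :=
  \sum_i \sum_j a i j * (x i)%:R * (x j)%:R.

(** Zeroing the diagonal lets sums over i != j be handled as full double sums by the lemmas on
    quadratic forms. *)
Definition offdiag i j : R := if i == j then 0 else a i j.

Definition lin_coef i : R :=
  a i i + \sum_j (offdiag i j + offdiag j i) * p j.

(** Majorant of |b_i| that stays linear in |a_ij|, so that summing it over i reproduces the sums in
    the final bound. *)
Definition lin_bound i : R :=
  `|a i i| + \sum_j (`|offdiag i j| + `|offdiag j i|) * p j.

Let z i (x : {ffun I -> bool}) := ctr (p i) (x i).

Lemma sum_offdiag (f : R -> I -> I -> R) : (forall i j, f 0 i j = 0) ->
  \sum_i \sum_j f (offdiag i j) i j = \sum_i \sum_(j | i != j) f (a i j) i j.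
Proof.
move=> f0; apply: eq_bigr => i _; rewrite [RHS]big_mkcond/=.
by apply: eq_bigr => j _; rewrite /offdiag; case: eqP; rewrite ?f0.
Qed.

Lemma sum_split_diag (g : I -> R) i :
  \sum_j g j = g i + \sum_j (if i == j then 0 else g j).
Proof.
rewrite (bigD1 i)//= big_mkcond/=; congr (_ + _); apply: eq_bigr => j _.
by rewrite eq_sym; case: eqP.
Qed.

Lemma offdiag_row i : \sum_j `|offdiag i j| <= D.
Proof.
apply: le_trans (a_row i); apply: ler_sum => j _.
by rewrite /offdiag; case: eqP; rewrite ?normr0.
Qed.

Lemma offdiag_col j : \sum_i `|offdiag i j| <= D.
Proof.
apply: le_trans (a_col j); apply: ler_sum => i _.
by rewrite /offdiag; case: eqP; rewrite ?normr0.
Qed.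

(** Substitute x_i = z_i + p_i; since x_i^2 = x_i, diagonal entries feed only the linear and
    constant parts. *)
Lemma boolean_chaosE x : boolean_chaos x =
  \sum_i \sum_j offdiag i j * z i x * z j x + \sum_i lin_coef i * z i x +
  \sum_i (a i i * p i + \sum_j offdiag i j * p i * p j).
Proof.
have bb (b : bool) : b%:R * b%:R = b%:R :> R by case: b; rewrite ?mulr1 ?mulr0.
have E1 : \sum_i (\sum_j offdiag j i * p j) * z i x =
          \sum_i \sum_j offdiag i j * p i * z j x.
  by rewrite exchange_big/=; apply: eq_bigr => i _; rewrite mulr_suml.
have E2 : \sum_i lin_coef i * z i x =
    \sum_i (a i i * z i x + \sum_j offdiag i j * p j * z i x) +
    \sum_i \sum_j offdiag i j * p i * z j x.
  rewrite -E1 -big_split/=; apply: eq_bigr => i _.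
  rewrite /lin_coef mulrDl -addrA; congr (_ + _).
  by rewrite !mulr_suml -big_split/=; apply: eq_bigr => j _; ring.
rewrite E2 -!big_split/=; apply: eq_bigr => i _.
rewrite (sum_split_diag _ i) -mulrA bb.
rewrite (_ : \sum_j (if i == j then 0 else a i j * (x i)%:R * (x j)%:R) =
  \sum_j (offdiag i j * z i x * z j x + offdiag i j * p j * z i x +
          offdiag i j * p i * z j x + offdiag i j * p i * p j)).
  rewrite !big_split/= (_ : (x i)%:R = z i x + p i); first ring.
  by rewrite /z /ctr subrK.
apply: eq_bigr => j _; rewrite /offdiag /z /ctr; case: ifP => _; ring.
Qed.

Lemma Ex_boolean_chaos :
  Ex p boolean_chaos = \sum_i (a i i * p i + \sum_j offdiag i j * p i * p j).
Proof.
have z0 i : p i * ctr (p i) true + (1 - p i) * ctr (p i) false = 0.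
  by rewrite /ctr/=; ring.
rewrite (eq_Ex _ boolean_chaosE) !ExD Ex_cst !Ex_sum.
rewrite big1 ?add0r => [|i _]; last first.
  rewrite Ex_sum big1// => j _; have [<-|ij] := eqVneq i j.
    by rewrite /offdiag eqxx (@eq_Ex _ _ _ _ (fun=> 0)) ?Ex_cst// => x; ring.
  rewrite (@eq_Ex _ _ _ _ (fun x => offdiag i j * (z i x * z j x))).
    by rewrite ExZ (Ex_coord2 _ (ctr (p i)) (ctr (p j)) ij) z0 mul0r mulr0.
  by move=> x; rewrite mulrA.
by rewrite big1 ?add0r// => i _; rewrite ExZ (Ex_coord _ _ (ctr (p i))) z0 mulr0.
Qed.

Let p0 i : 0 <= p i. Proof. by case/andP: (p01 i). Qed.

Lemma norm_lin_coef i : `|lin_coef i| <= lin_bound i.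
Proof.
apply: le_trans (ler_normD _ _) _; rewrite lerD2l.
apply: le_trans (ler_norm_sum _ _ _) _; apply: ler_sum => j _.
by rewrite normrM (ger0_norm (p0 j)) ler_wpM2r// ler_normD.
Qed.

(** Row sum plus column sum at i dominates [lin_bound i]: it counts |a_ii| twice instead of once,
    and the weights p_j are at most 1. *)
Lemma lin_bound_le i : lin_bound i <= 2 * D.
Proof.
apply: (@le_trans _ _ (\sum_j `|a i j| + \sum_j `|a j i|)); last first.
  by rewrite mulrDl mul1r lerD.
rewrite (sum_split_diag (fun j => `|a i j|) i).
rewrite (sum_split_diag (fun j => `|a j i|) i) /lin_bound.
rewrite -addrA lerD2l addrCA -[leLHS]add0r lerD// -big_split/=.
apply: ler_sum => j _; have /andP[_ p1] := p01 j.
rewrite /offdiag [j == i]eq_sym; case: ifP => _; first by rewrite normr0 addr0 mul0r.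
by rewrite ler_piMr ?addr_ge0.
Qed.

Lemma chaos_mgf_le (lam : R) : `|lam| * D <= 1 / 16 ->
  Ex p (fun x => expR (lam * (boolean_chaos x - Ex p boolean_chaos))) <=
  expR (65 / 2 * lam ^+ 2 * D * expR (8 * `|lam| * D) *
        \sum_i \sum_(j | i != j)
          `|a i j| * (p i * (1 - p i)) * (p j * (1 - p j))) *
  expR (2 * lam ^+ 2 * D * expR (4 * `|lam| * D) *
        (\sum_i `|a i i| * (p i * (1 - p i)) +
         2 * \sum_i \sum_(j | i != j) `|a i j| * p i * p j)).
Proof.
move=> lD; set al := 65 / 2 * _ * _ * _ * _; set be := 2 * _ * _ * _ * _.
pose Q x := \sum_i \sum_j offdiag i j * z i x * z j x.
pose L x := \sum_i lin_coef i * z i x.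
have v0 i : 0 <= p i * (1 - p i).
  by rewrite mulr_ge0// subr_ge0; case/andP: (p01 i).
have D0 (i : I) : 0 <= D by apply: le_trans (a_row i); apply: sumr_ge0.
have HQ : Ex p (fun x => expR (2 * lam * Q x)) <= expR (2 * al).
  apply: le_trans (quadratic_mgf_le p01 offdiag_row offdiag_col _ lD) _.
    by move=> i; rewrite /offdiag eqxx.
  rewrite ler_expR (sum_offdiag (f := fun t i j =>
    `|t| * (p i * (1 - p i)) * (p j * (1 - p j)))); last first.
    by move=> i j; rewrite normr0 !mul0r.
  (* The quadratic part yields 64, while 2 * (65/2) = 65 leaves a little slack. *)
  rewrite /al; set W := \sum_i _; rewrite [leRHS](_ : _ =
    65 * (lam ^+ 2 * D * expR (8 * `|lam| * D) * W)); last by field.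
  rewrite [leLHS](_ : _ = 64 * (lam ^+ 2 * D * expR (8 * `|lam| * D) * W));
    last by ring.
  rewrite ler_wpM2r ?ler_nat// /W mulr_sumr; apply: sumr_ge0 => i _.
  apply: mulr_ge0.
    exact: mulr_ge0 (mulr_ge0 (sqr_ge0 lam) (D0 i)) (expR_ge0 _).
  by apply: sumr_ge0 => j _; rewrite mulr_ge0// mulr_ge0.
have HL : Ex p (fun x => expR (2 * lam * L x)) <= expR (2 * be).
  rewrite (@eq_Ex _ _ _ _ (fun x =>
      expR (\sum_i (2 * lam * lin_coef i) * ctr (p i) (x i)))); last first.
    by move=> x; rewrite /L mulr_sumr; under eq_bigr do rewrite mulrA.
  (* The coefficients are 2 lam b_i with |b_i| <= 2 D, whence M = 4 |lam| D. *)
  apply: le_trans (linear_mgf_le p01 (M := 4 * `|lam| * D) _) _.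
    move=> i; rewrite !normrM ger0_norm//.
    rewrite [leRHS](_ : _ = 2 * `|lam| * (2 * D)); last by ring.
    by rewrite ler_wpM2l ?mulr_ge0// (le_trans (norm_lin_coef i)) ?lin_bound_le.
  rewrite ler_expR.
  apply: (@le_trans _ _ (\sum_i (4 * lam ^+ 2 * D * expR (4 * `|lam| * D)) *
      (`|a i i| * (p i * (1 - p i)) +
       \sum_j (`|offdiag i j| + `|offdiag j i|) * p i * p j))).
    apply: ler_sum => i _; have Di := D0 i.
    apply: (@le_trans _ _ ((4 * lam ^+ 2 * D * expR (4 * `|lam| * D)) *
        (lin_bound i * (p i * (1 - p i))))).
      (* Only one factor |b_i| is replaced by 2 D; the other is kept as [lin_bound i] for the
         summation over i. *)
      have bB : lin_coef i ^+ 2 <= 2 * D * lin_bound i.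
        rewrite -real_normK ?num_real// expr2.
        by rewrite ler_pM// ?norm_lin_coef// (le_trans (norm_lin_coef i))//
                   lin_bound_le.
      rewrite [leLHS](_ : _ = (2 * lam ^+ 2 * expR (4 * `|lam| * D) *
        (p i * (1 - p i))) * lin_coef i ^+ 2); last by field.
      rewrite [leRHS](_ : _ = (2 * lam ^+ 2 * expR (4 * `|lam| * D) *
        (p i * (1 - p i))) * (2 * D * lin_bound i)); last by ring.
      by rewrite ler_wpM2l// mulr_ge0// mulr_ge0 ?expR_ge0// mulr_ge0 ?sqr_ge0.
    rewrite ler_wpM2l//.
      by rewrite mulr_ge0 ?expR_ge0// mulr_ge0// mulr_ge0 ?sqr_ge0.
    (* Diagonal terms keep the variance; off the diagonal p_i (1 - p_i) <= p_i gives the products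
       p_i p_j. *)
    rewrite /lin_bound mulrDl lerD2l mulr_suml; apply: ler_sum => j _.
    rewrite -[leLHS]mulrA [leRHS](_ : _ = (`|offdiag i j| + `|offdiag j i|) * (p j * p i));
      last by ring.
    rewrite ler_wpM2l ?addr_ge0// ler_wpM2l//.
    by rewrite ler_piMr// gerBl.
  rewrite -mulr_sumr /be le_eqVlt; apply/orP; left; apply/eqP.
  (* A row sum and its transpose both equal [S2], which explains the factor 2 in front of the
     off-diagonal sum. *)
  set S2 := \sum_i \sum_(j | i != j) _.
  have S2E : \sum_i \sum_j `|offdiag i j| * p i * p j = S2.
    rewrite (sum_offdiag (f := fun t i j => `|t| * p i * p j))// => i j.
    by rewrite normr0 !mul0r.
  have S2E' : \sum_i \sum_j `|offdiag j i| * p i * p j = S2.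
    rewrite exchange_big -S2E /=; apply: eq_bigr => i _; apply: eq_bigr => j _.
    by rewrite mulrAC.
  rewrite big_split/= (_ : \sum_i \sum_j _ = 2 * S2); first by ring.
  rewrite [RHS](_ : _ = S2 + S2); last by ring.
  rewrite -{1}S2E -S2E' -big_split/=; apply: eq_bigr => i _.
  by rewrite -big_split/=; apply: eq_bigr => j _; rewrite !mulrDl.
(* Cauchy-Schwarz, as AM-GM applied to the normalised exponentials. *)
rewrite -expRD.
have ptw x : expR (lam * (boolean_chaos x - Ex p boolean_chaos)) <=
    expR (al + be) / 2 * (expR (2 * lam * Q x) * expR (- (2 * al)) +
                          expR (2 * lam * L x) * expR (- (2 * be))).
  rewrite Ex_boolean_chaos boolean_chaosE addrK -/(Q x) -/(L x) -!expRD.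
  pose u := expR (lam * Q x - al); pose v := expR (lam * L x - be).
  rewrite [leLHS](_ : _ = expR (al + be) * (u * v)); last first.
    by rewrite -!expRD; congr expR; ring.
  rewrite (_ : expR (2 * lam * Q x + _) = u * u); last first.
    by rewrite -expRD; congr expR; ring.
  rewrite (_ : expR (2 * lam * L x + _) = v * v); last first.
    by rewrite -expRD; congr expR; ring.
  rewrite -mulrA ler_wpM2l ?expR_ge0//.
  by clear D0; have := sqr_ge0 (u - v); rewrite expr2; lra.
apply: le_trans (le_Ex p01 ptw) _.
rewrite ExZ ExD !ExZr -[leRHS]mulr1 -mulrA ler_wpM2l ?expR_ge0//.
have HQ' : Ex p (fun x => expR (2 * lam * Q x)) * expR (- (2 * al)) <= 1.
  by rewrite expRN ler_pdivrMr ?expR_gt0// mul1r.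
have HL' : Ex p (fun x => expR (2 * lam * L x)) * expR (- (2 * be)) <= 1.
  by rewrite expRN ler_pdivrMr ?expR_gt0// mul1r.
by clear D0; lra.
Qed.

End chaos.

(** * Transfer from the probability space to the cube *)

Section law_of_bernoulli_vector.
Context (d : measure_display) (T : measurableType d) (R : realType).
Context (P : probability T R) (m : nat) (xi : 'I_m -> {RV P >-> R}).
Context (p : 'I_m -> R).
Hypothesis xi_bern : forall i, is_bernoulli (xi i) (p i).
Hypothesis xi_indep : mutually_independent xi.

Lemma is_bernoulli_param i : 0 <= p i <= 1.
Proof.
have [h1 h0] := xi_bern i.
rewrite -lee_fin -h1 measure_ge0/= -subr_ge0 -lee_fin -h0.
exact: measure_ge0.
Qed.

Definition atom (x : {ffun 'I_m -> bool}) : set T :=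
  \bigcap_(i in [set` [set: 'I_m]%SET]) (xi i @^-1` [set (x i)%:R]).

Lemma measurable_preimage_RV i (r : R) : measurable (xi i @^-1` [set r]).
Proof. by rewrite -[X in measurable X]setTI; exact: measurable_funP. Qed.

Lemma measurable_atom x : measurable (atom x).
Proof.
by apply: fin_bigcap_measurable => // i _; exact: measurable_preimage_RV.
Qed.

Lemma atomE x w : atom x w <-> forall i, xi i w = (x i)%:R.
Proof.
split=> [h i|h i _]; last exact: h.
by apply: h; rewrite /= finset.in_setT.
Qed.

Lemma probability_atom x : P (atom x) = (wt p x)%:E.
Proof.
rewrite (xi_indep _ (fun i => measurable_set1 _)).
rewrite /wt -prodEFin; apply: eq_big => [i|i _]; first by rewrite finset.in_setT.
by have [h1 h0] := xi_bern i; rewrite /bern; case: (x i).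
Qed.

(** The masses p_i and 1 - p_i add up to 1, so other values have probability zero; finitely many
    null sets are then combined. *)
Lemma ae_boolean : {ae P, forall w, forall i, xi i w = (xi i w == 1)%:R}.
Proof.
apply: filter_forall => i.
have mU : measurable (xi i @^-1` [set 1] `|` xi i @^-1` [set 0]).
  by apply: measurableU; exact: measurable_preimage_RV.
exists (~` (xi i @^-1` [set 1] `|` xi i @^-1` [set 0])); split.
- exact: measurableC.
- rewrite probability_setC// measureU; [|exact: measurable_preimage_RV..|].
    have [h1 h0] := xi_bern i.
    transitivity (1 - ((p i)%:E + (1 - p i)%:E))%E; first by congr (_ - (_ + _))%E.
    by rewrite -EFinD subrKC subrr.
  by apply/seteqP; split=> // w [/= -> /eqP]; rewrite oner_eq0.
- apply: subsetC => w [] /= ->; rewrite ?eqxx//.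
  by rewrite eq_sym oner_eq0.
Qed.

(** The atoms cover the space up to a null set, so h agrees almost everywhere with a simple function
    taking the value g(x) on [atom x]. *)
Lemma expectation_boolean (h : T -> R) (g : {ffun 'I_m -> bool} -> R) :
  measurable_fun setT h -> (forall x w, atom x w -> h w = g x) ->
  ('E_P[h] = (Ex p g)%:E)%E.
Proof.
move=> mh hg; rewrite unlock.
transitivity (\int[P]_w (\sum_x (g x)%:E * (\1_(atom x) w)%:E))%E.
  apply: ae_eq_integral => //.
  - exact/measurable_EFinP.
  - apply: emeasurable_sum => x; apply: measurable_funeM.
    by apply/measurable_EFinP; exact/measurable_indic/measurable_atom.
  have := ae_boolean; apply: filterS => w w01 _.
  pose x := [ffun i => xi i w == 1].
  have xw : atom x w by apply/atomE => i; rewrite ffunE.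
  rewrite (hg _ _ xw) (bigD1 x)//= indicE mem_set// mule1 big1 ?adde0// => y yx.
  rewrite indicE memNset ?mule0// => yw; move/eqP: yx; apply.
  apply/ffunP => i; move/atomE: yw => /(_ i); move/atomE: xw => /(_ i) ->.
  by case: (x i); case: (y i) => //= /eqP; rewrite ?oner_eq0 1?eq_sym ?oner_eq0.
rewrite integral_sum//=; last first.
  move=> x; apply: integrableZl => //.
  by apply: integrable_indic; exact: measurable_atom.
rewrite /Ex -sumEFin; apply: eq_bigr => x _.
rewrite integralZl//; last by apply: integrable_indic; exact: measurable_atom.
rewrite integral_indic//; last exact: measurable_atom.
rewrite setIT mulrC EFinM; congr (_ * _)%E; exact: probability_atom.
Qed.

End law_of_bernoulli_vector.

(** * The random quadratic form as a function on the cube, and the conclusion *)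

Section quadratic_form_law.
Context (d : measure_display) (T : measurableType d) (R : realType).
Context (P : probability T R) (m : nat) (A : 'M[R]_m) (xi : 'I_m -> {RV P >-> R}).

Lemma measurable_quadratic_form : measurable_fun setT (quadratic_form A xi).
Proof.
apply: measurable_sum => i; apply: measurable_sum => j.
by apply: measurable_funM => //; apply: measurable_funM.
Qed.

Lemma quadratic_form_atom x w : atom xi x w ->
  quadratic_form A xi w = boolean_chaos A x.
Proof.
move=> /atomE xw; apply: eq_bigr => i _; apply: eq_bigr => j _.
by rewrite !xw.
Qed.

End quadratic_form_law.

Lemma row_sum_le_mx_norm_oo (R : realType) m (A : 'M[R]_m) i :
  \sum_j `|A i j| <= mx_norm_oo A.
Proof. exact: (le_bigmax _ (fun i => \sum_j `|A i j|)). Qed.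

Lemma col_sum_le_mx_norm_1 (R : realType) m (A : 'M[R]_m) j :
  \sum_i `|A i j| <= mx_norm_1 A.
Proof. exact: (le_bigmax _ (fun j => \sum_i `|A i j|)). Qed.

Theorem theorem2p5 (R : realType) (d : measure_display) (T : measurableType d)
    (P : probability T R) (m : nat) (xi : 'I_m -> {RV P >-> R}) (p : 'I_m -> R)
    (A : 'M[R]_m) (lambda : R) :
  (forall i, is_bernoulli (xi i) (p i)) ->
  mutually_independent xi ->
  let sigma2 i := p i * (1 - p i) in
  let Dmax := Num.max (mx_norm_oo A) (mx_norm_1 A) in
  let Sstar w := quadratic_form A xi w - fine 'E_P[quadratic_form A xi] in
  (`|lambda|%:E <= 1 / (16 * Num.max (mx_norm_1 A) (mx_norm_oo A))%:E)%E ->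
  ('E_P[fun w => expR (lambda * Sstar w)] <=
   (expR (65 / 2 * lambda ^+ 2 * Dmax * expR (8 * `|lambda| * Dmax) *
          \sum_(i < m) \sum_(j < m | i != j)
             `|A i j| * sigma2 i * sigma2 j) *
    expR (2 * lambda ^+ 2 * Dmax * expR (4 * `|lambda| * Dmax) *
          (\sum_(i < m) `|A i i| * sigma2 i +
           2 * \sum_(i < m) \sum_(j < m | i != j)
                 `|A i j| * p i * p j)))%:E)%E.
Proof.
move=> xi_bern xi_indep sigma2 Dmax Sstar lam_le.
have p01 := is_bernoulli_param xi_bern.
have law := expectation_boolean xi_bern xi_indep.
have D0 : 0 <= Dmax by rewrite le_max /mx_norm_oo bigmax_ge_id.
have lD : `|lambda| * Dmax <= 1 / 16.
  (* In the extended reals 1/0 is +oo, so [lambda] is unrestricted when [Dmax] = 0; the product is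
     then 0. *)
  have [->|D_neq0] := eqVneq Dmax 0; first by rewrite mulr0; lra.
  have D_gt0 : 0 < Dmax by rewrite lt_neqAle eq_sym D_neq0.
  move: lam_le; rewrite maxC -/Dmax div1e inver mulf_eq0 pnatr_eq0/= (negbTE D_neq0).
  rewrite lee_fin invfM => h; rewrite -ler_pdivlMr//.
  by apply: le_trans h _; rewrite div1r.
have a_row i : \sum_j `|A i j| <= Dmax.
  by rewrite (le_trans (row_sum_le_mx_norm_oo A i))// le_max lexx.
have a_col j : \sum_i `|A i j| <= Dmax.
  by rewrite (le_trans (col_sum_le_mx_norm_1 A j))// le_max lexx orbT.
have mq := measurable_quadratic_form A xi.
have mean : fine 'E_P[quadratic_form A xi] = Ex p (boolean_chaos A).
  by rewrite (law _ (boolean_chaos A) mq) // => x w; exact: quadratic_form_atom.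
(* With the mean identified, the expectation becomes a finite sum over the cube, where
   [chaos_mgf_le] applies. *)
rewrite (law _ (fun x => expR (lambda *
    (boolean_chaos A x - Ex p (boolean_chaos A))))); first last.
- by move=> x w /(quadratic_form_atom A) <-; rewrite /Sstar mean.
- apply: measurableT_comp => //; apply: measurable_funM => //.
  exact: measurable_funB.
by rewrite lee_fin; exact: chaos_mgf_le.
Qed.
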